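(* Let $f\in\mathcal{A}$ and let $(g_i)_{i\in I}$ be a family of arithmetic functions. Suppose $$[\operatorname{supp} f]\not\subseteq\bigcup_{i\in I}[\operatorname{supp} g_i].$$ Then $\operatorname{Exp}^*\{f\}$ is algebraically independent over the $\mathbb{C}$-subalgebra of $\mathcal{A}$ generated by the $g_i$ $(i\in I)$.
   Context: $\mathbb{N}=\{1,2,3,\dots\}$. An arithmetic function is a function $f:\mathbb{N}\to\mathbb{C}$. $\mathcal{A}$ is the commutative $\mathbb{C}$-algebra (an integral domain) of arithmetic functions under pointwise addition and convolution $(f*g)(n)=\sum_{d\mid n}f(d)g(n/d)$; $\alpha\in\mathbb{C}$ is identified with the function $1\mapsto\alpha$, $n\mapsto 0$ for $n>1$. All products and powers are convolution products. $\operatorname{supp} f=\{n\in\mathbb{N}:f(n)\ne0\}$; for $A\subseteq\mathbb{N}$, $[A]$ is the set of primes dividing some member of $A$. For $f\ne 0$ let $v(f)$ be the least element of $\operatorname{supp} f$, and $v(0)=\infty$; $\|f\|=1/v(f)$ (with $1/\infty=0$) is a non-archimedean norm giving a topology on $\mathcal{A}$. If $f(1)=0$, $\operatorname{Exp}(f)=\sum_{k\ge0}f^k/k!$ (convergent in this topology); in general $\operatorname{Exp}(f)=\exp(f(1))*\operatorname{Exp}(f-f(1))$. Let $\mathcal{A}_{\mathbb{R}}=\{f:f(1)\in\mathbb{R}\}$ and $\mathcal{A}_+=\{f:f(1)\in\mathbb{R},\,f(1)>0\}$. $\operatorname{Exp}$ restricts to a group isomorphism $(\mathcal{A}_{\mathbb{R}},+)\to(\mathcal{A}_+,*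 )$ with inverse $\operatorname{Log}$. $\operatorname{Exp}^m$ denotes $m$-fold composition for $m\ge 0$ ($\operatorname{Exp}^0=\mathrm{id}$), and $\operatorname{Exp}^{-k}=\operatorname{Log}^k$ (where defined) for $k\ge1$. For each $f\in\mathcal{A}$ there is a largest $k\ge0$ such that $\operatorname{Log}^kf$ is defined. For nonempty $W\subseteq\mathcal{A}$, $k_W$ is the largest $k\ge0$ such that $\operatorname{Log}^{k}f$ is defined for every $f\in W$, and $\operatorname{Exp}^*W=\{\operatorname{Exp}^mf: f\in W,\ m\in\mathbb{Z},\ m\ge -k_W\}$. *)

(* Defs.v *)
From HB Require Import structures.
From mathcomp Require Import all_boot all_order all_algebra.
From mathcomp Require Import all_classical all_reals all_analysis.
From mathcomp Require Import complex.
From mathcomp Require Import -(notations) mpoly.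
From mathcomp Require Import zify lra.

Set Implicit Arguments.
Unset Strict Implicit.
Unset Printing Implicit Defensive.

Import Order.TTheory GRing.Theory Num.Theory.

Local Open Scope classical_set_scope.
Local Open Scope ring_scope.
Local Open Scope complex_scope.

Local Open Scope complex_scope.

(* The positive integers are embedded in [nat]: an arithmetic function is a
   function on [nat] whose (meaningless) value at 0 is pinned to 0, so that
   equality of functions is equality on {1, 2, 3, ...}. *)
Record arith (R : realType) := Arith {
  arith_fun :> nat -> R[i];
  arith_fun0 : arith_fun 0%N == 0 }.

HB.instance Definition _ (R : realType) := [isSub for @arith_fun R].
HB.instance Definition _ (R : realType) := [Choice of arith R by <:].

HB.lock Definition mk_arith (R : realType) (u : nat -> R[i]) : arith R :=
  @Arith R (fun n => if n is 0%N then 0 else u n) (eqxx 0).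

HB.lock Definition arith_conv (R : realType) (f g : arith R) : arith R :=
  mk_arith (fun n => \sum_(d <- divisors n) f d * g (n %/ d)%N).

Section Algebra.
Variable R : realType.
Local Notation C := R[i].
Local Notation A := (arith R).
Implicit Types f g h : A.

Lemma arithP f g : (forall n, (0 < n)%N -> f n = g n) <-> f = g.
Proof.
split=> [fg|->//]; apply/val_inj/funext => -[|n] /=; last exact: fg.
by rewrite (eqP (arith_fun0 f)) (eqP (arith_fun0 g)).
Qed.

Lemma mk_arithE (u : nat -> C) n : (0 < n)%N -> mk_arith u n = u n.
Proof. by rewrite mk_arith.unlock; case: n. Qed.

Definition arith_zero : A := mk_arith (fun=> 0).
Definition arith_opp f : A := mk_arith (fun n => - f n).
Definition arith_add f g : A := mk_arith (fun n => f n + g n).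
Definition arith_scale (a : C) f : A := mk_arith (fun n => a * f n).
Definition arith_one : A := mk_arith (fun n => (n == 1%N)%:R).

Lemma arith_convE f g n : (0 < n)%N ->
  arith_conv f g n = \sum_(d <- divisors n) f d * g (n %/ d)%N.
Proof. by move=> n0; rewrite arith_conv.unlock mk_arithE. Qed.

Lemma arith_addA : associative arith_add.
Proof. by move=> f g h; apply/arithP => n n0; rewrite !mk_arithE// addrA. Qed.

Lemma arith_addC : commutative arith_add.
Proof. by move=> f g; apply/arithP => n n0; rewrite !mk_arithE// addrC. Qed.

Lemma arith_add0 : left_id arith_zero arith_add.
Proof. by move=> f; apply/arithP => n n0; rewrite !mk_arithE// add0r. Qed.

Lemma arith_addN : left_inverse arith_zero arith_opp arith_add.
Proof. by move=> f; apply/arithP => n n0; rewrite !mk_arithE// addNr. Qed.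

HB.instance Definition _ :=
  GRing.isZmodule.Build A arith_addA arith_addC arith_add0 arith_addN.

Lemma arith_conv2E N f g n : (0 < n < N)%N ->
  arith_conv f g n =
  \sum_(i < N) \sum_(j < N | (i * j)%N == n) f i * g j.
Proof.
move=> /andP[n0 nN]; rewrite arith_convE//.
have -> : \sum_(d <- divisors n) f d * g (n %/ d)%N =
    \sum_(i < N | (i %| n)%N) f i * g (n %/ i)%N.
  rewrite -(big_mkord (fun i => (i %| n)%N) (fun i => f i * g (n %/ i)%N)).
  rewrite -[RHS]big_filter; apply/perm_big/uniq_perm => //.
  - exact: divisors_uniq.
  - by rewrite filter_uniq// iota_uniq.
  - move=> d; rewrite mem_filter mem_index_iota -dvdn_divisors//=.
    by case: (boolP (d %| n)%N) => // /(dvdn_leq n0) /leq_ltn_trans ->.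
rewrite big_mkcond/=; apply: eq_bigr => i _; case: ifPn => [idn|ndvd].
- have i0 : (0 < i)%N by apply: dvdn_gt0 idn.
  have jN : (n %/ i < N)%N by rewrite (leq_ltn_trans (leq_div _ _)).
  rewrite (big_pred1 (Ordinal jN)) // => j /=.
  apply/eqP/eqP => [ijn|->]; last by rewrite /= mulnC divnK.
  by apply: val_inj; rewrite /= -ijn mulKn.
- rewrite big_pred0// => j; apply: contraNF ndvd => /eqP <-.
  exact: dvdn_mulr.
Qed.

Lemma arith_convC : commutative (@arith_conv R).
Proof.
move=> f g; apply/arithP => n n0.
rewrite !(@arith_conv2E n.+1) ?n0 ?ltnSn//=.
under eq_bigr do rewrite big_mkcond/=.
rewrite exchange_big/=; apply: eq_bigr => i _; rewrite [RHS]big_mkcond/=.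
by apply: eq_bigr => j _; rewrite mulnC mulrC.
Qed.

Lemma arith_conv3E f g h n : (0 < n)%N ->
  arith_conv (arith_conv f g) h n =
  \sum_(i < n.+1) \sum_(j < n.+1) \sum_(k < n.+1)
    if (i * j * k == n)%N then f i * g j * h k else 0.
Proof.
move=> n0; rewrite (@arith_conv2E n.+1) ?n0 ?ltnSn//.
transitivity (\sum_(m < n.+1) \sum_(k < n.+1) \sum_(i < n.+1) \sum_(j < n.+1)
   if ((i * j)%N == m) && (m * k == n)%N then f i * g j * h k else 0).
  apply: eq_bigr => m _; rewrite big_mkcond; apply: eq_bigr => k _.
  case: ifPn => [/eqP mk|/negPf mk].
    have m0 : (0 < m)%N by case: (m : nat) mk => //; rewrite mul0n => /esym; lia.
    rewrite (@arith_conv2E n.+1) ?m0 //; last exact: ltn_ord.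
    rewrite mulr_suml; apply: eq_bigr => i _.
    rewrite mulr_suml big_mkcond; apply: eq_bigr => j _.
    by rewrite andbT.
  by rewrite big1// => i _; rewrite big1// => j _; rewrite andbF.
under eq_bigr do rewrite exchange_big/=.
rewrite exchange_big/=; apply: eq_bigr => i _.
under eq_bigr do rewrite exchange_big/=.
rewrite exchange_big/=; apply: eq_bigr => j _.
rewrite exchange_big/=; apply: eq_bigr => k _.
have [ijk|ijk] := eqVneq (i * j * k)%N n; last first.
  rewrite big1// => m _; case: ifP => // /andP[/eqP ijm mk].
  by rewrite ijm mk in ijk.
have ijn : (i * j < n.+1)%N.
  have k0 : (0 < k)%N by move: ijk; case: (k : nat) => //; rewrite muln0; lia.
  by rewrite ltnS (leq_trans (leq_pmulr _ k0))// ijk.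
rewrite (bigD1 (Ordinal ijn))//= eqxx ijk eqxx/= big1 ?addr0// => m mij.
by rewrite ifF//; apply/negbTE; rewrite negb_and eq_sym -[X in X || _]/(m != Ordinal ijn) mij.
Qed.

Lemma arith_convA : associative (@arith_conv R).
Proof.
move=> f g h; rewrite (arith_convC f); apply/arithP => n n0.
rewrite !arith_conv3E// [RHS]exchange_big/=; apply: eq_bigr => i _.
rewrite [RHS]exchange_big/=; apply: eq_bigr => j _; apply: eq_bigr => k _.
have -> : (i * j * k = k * i * j)%N by lia.
by rewrite (mulrC _ (f k)) mulrA.
Qed.

Lemma arith_conv1 : left_id arith_one (@arith_conv R).
Proof.
move=> f; apply/arithP => n n0; rewrite (@arith_conv2E n.+1) ?n0 ?ltnSn//.
have n1 : (1 < n.+1)%N by [].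
rewrite (bigD1 (Ordinal n1))//= [X in _ + X]big1 ?addr0 => [|i i1].
  rewrite (big_pred1 ord_max) => [|j]; last by rewrite mul1n.
  by rewrite mk_arithE// mul1r.
rewrite big1// => j _; case: i i1 => -[|[|i]] iN //= _; by rewrite ?(eqP (arith_fun0 _)) ?mk_arithE// mul0r.
Qed.

Lemma arith_convDl : left_distributive (@arith_conv R) arith_add.
Proof.
move=> f g h; apply/arithP => n n0; rewrite !(arith_convE, mk_arithE)// -big_split/=.
apply: eq_bigr => d _; case: d => [|d]; last by rewrite mk_arithE// mulrDl.
by rewrite !(eqP (arith_fun0 _)) !mul0r addr0.
Qed.

Lemma arith_one_neq0 : arith_one != arith_zero.
Proof.
apply/eqP => /(congr1 (fun f : A => f 1%N)) /eqP.
by rewrite !mk_arithE// oner_eq0.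
Qed.

HB.instance Definition _ := GRing.Zmodule_isComNzRing.Build A
  arith_convA arith_convC arith_conv1 arith_convDl arith_one_neq0.

Lemma arith_scaleA (a b : C) f :
  arith_scale a (arith_scale b f) = arith_scale (a * b) f.
Proof. by apply/arithP => n n0; rewrite !mk_arithE// mulrA. Qed.

Lemma arith_scale1 : left_id 1 arith_scale.
Proof. by move=> f; apply/arithP => n n0; rewrite !mk_arithE// mul1r. Qed.

Lemma arith_scaleDr : right_distributive arith_scale +%R.
Proof. by move=> a f g; apply/arithP => n n0; rewrite !mk_arithE// mulrDr. Qed.

Lemma arith_scaleDl f : {morph arith_scale^~ f : a b / a + b}.
Proof. by move=> a b; apply/arithP => n n0; rewrite !mk_arithE// mulrDl. Qed.

HB.instance Definition _ := GRing.Zmodule_isLmodule.Build C A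
  arith_scaleA arith_scale1 arith_scaleDr arith_scaleDl.

Lemma arith_scaleAl (a : C) f g : a *: (f * g) = (a *: f) * g.
Proof.
apply/arithP => n n0; rewrite !(arith_convE, mk_arithE)// mulr_sumr.
apply: eq_bigr => d _; case: d => [|d]; last by rewrite mk_arithE// mulrA.
by rewrite !(eqP (arith_fun0 _)) !mul0r mulr0.
Qed.

HB.instance Definition _ := GRing.Lmodule_isLalgebra.Build C A arith_scaleAl.
HB.instance Definition _ := GRing.Lalgebra_isComAlgebra.Build C A.

End Algebra.

Section Topology.
Variable R : realType.
Local Notation C := R[i].
Local Notation A := (arith R).
Implicit Types f g : A.

Definition supp f : set nat := [set n | f n != 0].

(* [None] stands for infinity *)
Definition arith_val f : option nat :=
  if pselect (exists n, f n != 0) is left fn0 then Some (ex_minn fn0) else None.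

Definition arith_norm f : R :=
  if arith_val f is Some n then n%:R^-1 else 0.

Lemma arith_norm_witness f :
  arith_norm f = 0 /\ f = 0 \/
  exists n, [/\ (0 < n)%N, f n != 0 & arith_norm f = n%:R^-1].
Proof.
rewrite /arith_norm /arith_val; case: pselect => [fn0|nfn0] /=.
- right; case: ex_minnP => n fn _; exists n; split=> //.
  by case: n fn => //; rewrite (eqP (arith_fun0 f)) eqxx.
- left; split=> //; apply/arithP => n n0; rewrite [RHS]mk_arithE//.
  by apply: contra_notP nfn0 => /eqP ?; exists n.
Qed.

Lemma arith_norm_ge0 f : 0 <= arith_norm f.
Proof.
by have [[->]|[n [_ _ ->]]] := arith_norm_witness f; rewrite // invr_ge0.
Qed.

Lemma arith_norm_ge f n : f n != 0 -> n%:R^-1 <= arith_norm f.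
Proof.
move=> fn; rewrite /arith_norm /arith_val; case: pselect => [fn0|[]]; last by exists n.
case: ex_minnP => m fm /(_ _ fn) mn; rewrite lef_pV2 ?ler_nat// posrE ltr0n.
  by case: n fn {mn} => //; rewrite (eqP (arith_fun0 f)) eqxx.
by case: m fm {mn} => //; rewrite (eqP (arith_fun0 f)) eqxx.
Qed.

Lemma arith_normD f g :
  arith_norm (f + g) <= Num.max (arith_norm f) (arith_norm g).
Proof.
have [[-> _]|[n [n0 + ->]]] := arith_norm_witness (f + g).
  by rewrite le_max arith_norm_ge0.
rewrite le_max mk_arithE// => fgn; apply/orP.
have [fn|fn] := eqVneq (f n) 0; last by left; exact: arith_norm_ge.
by right; apply: arith_norm_ge; rewrite fn add0r in fgn.
Qed.

Definition arith_dist f g : R := arith_norm (f - g).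

Lemma arith_norm0 : arith_norm 0 = 0.
Proof.
have [[]//|[n [n0 + _]]] := arith_norm_witness 0.
by rewrite [X in X != _]mk_arithE// eqxx.
Qed.

Lemma arith_distxx f : arith_dist f f = 0.
Proof. by rewrite /arith_dist subrr arith_norm0. Qed.

Lemma arith_dist_positivity f g : arith_dist f g = 0 -> f = g.
Proof.
rewrite /arith_dist.
have [[_ /subr0_eq//]|[n [n0 _ ->]]] := arith_norm_witness (f - g).
by move=> /eqP; rewrite invr_eq0 pnatr_eq0 => /eqP n00; rewrite n00 in n0.
Qed.

Lemma arith_distC f g : arith_dist f g = arith_dist g f.
Proof.
have le (u w : A) : arith_dist u w <= arith_dist w u.
  rewrite /arith_dist; have [[-> _]|[n [n0 + ->]]] := arith_norm_witness (u - w).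
    exact: arith_norm_ge0.
  rewrite -opprB [X in X != _]mk_arithE// oppr_eq0; exact: arith_norm_ge.
by apply/eqP; rewrite eq_le !le.
Qed.

Lemma arith_dist_triangle g f h :
  arith_dist f h <= arith_dist f g + arith_dist g h.
Proof.
rewrite /arith_dist -(subrKA g f (- h)); apply: le_trans (arith_normD _ _) _.
by rewrite ge_max lerDl lerDr !arith_norm_ge0.
Qed.

HB.instance Definition _ := isPointed.Build A 0.
HB.instance Definition _ := isMetric.Build R A
  arith_distxx arith_dist_positivity arith_distC arith_dist_triangle.

End Topology.

HB.lock Definition Exp_series (R : realType) (f : arith R) : arith R :=
  limn (series (fun k => ((k`!%:R)^-1 : R[i]) *: f ^+ k)).

Section ExpLog.
Variable R : realType.
Local Notation C := R[i].
Local Notation A := (arith R).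
Implicit Types (f : A) (W : set A).

Definition cexp (z : C) : C :=
  let: x +i* y := z in (expR x * cos y) +i* (expR x * sin y).

(* [a%:A = a *: 1] is the function with value [a] at 1 and 0 elsewhere *)
Definition Exp f : A :=
  (cexp (f 1%N))%:A * Exp_series (f - (f 1%N)%:A).

Definition arith_real : set A := [set f | f 1%N \is Num.real].

(* In the order of [C], [0 < z] means that z is real and positive. *)
Definition arith_pos : set A := [set f | 0 < f 1%N].

(* The inverse of the bijection [Exp : arith_real -> arith_pos] (see [Exp_bij]
   below); meaningful on [arith_pos] only. *)
Definition Log : A -> A := 'pinv_(fun=> 0) arith_real Exp.

Definition Log_defined (k : nat) f : Prop :=
  forall j, (j < k)%N -> arith_pos (iter j Log f).

Definition Exp_iter (m : int) f : A :=
  match m with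
  | Posz n => iter n Exp f
  | Negz n => iter n.+1 Log f
  end.

Definition Log_depth_spec W (k : nat) : Prop :=
  (forall f, W f -> Log_defined k f) /\
  (forall j, (forall f, W f -> Log_defined j f) -> (j <= k)%N).

(* The default value 0 is never used when [W] is nonempty: see [Log_depthP]. *)
Definition Log_depth W : nat := xget 0%N (Log_depth_spec W).

Definition Exp_star W : set A :=
  [set h | exists f m, [/\ W f, - (Log_depth W)%:Z <= m & h = Exp_iter m f]].

End ExpLog.

Section ExpBijective.
Variable R : realType.
Local Notation C := R[i].
Local Notation A := (arith R).
Implicit Types f g h u w : A.

Let mulE u w n : (0 < n)%N ->
  (u * w) n = \sum_(d <- divisors n) u d * w (n %/ d)%N.
Proof. exact: arith_convE. Qed.

Let addE u w n : (u + w) n = u n + w n.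
Proof. by case: n => [|n]; [rewrite !(eqP (arith_fun0 _)) addr0|exact: mk_arithE]. Qed.

Let scaleE (a : C) u n : (a *: u) n = a * u n.
Proof. by case: n => [|n]; [rewrite !(eqP (arith_fun0 _)) mulr0|exact: mk_arithE]. Qed.

Let oppE u n : (- u) n = - u n.
Proof. by case: n => [|n]; [rewrite !(eqP (arith_fun0 _)) oppr0|exact: mk_arithE]. Qed.

Let zeroE n : (0 : A) n = 0.
Proof. by case: n => [|n]; [rewrite (eqP (arith_fun0 _))|exact: mk_arithE]. Qed.

Let oneE n : (1 : A) n = (n == 1%N)%:R.
Proof. by case: n => [|n]; [rewrite (eqP (arith_fun0 _))|exact: mk_arithE]. Qed.

Let sumE (F : nat -> A) N n :
  (\sum_(0 <= k < N) F k) n = \sum_(0 <= k < N) F k n.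
Proof. exact: (big_morph (fun u : A => u n) (fun u w => addE u w n) (zeroE n)). Qed.

Let expr_small h k n : h 1%N = 0 -> (n <= k)%N -> (h ^+ k) n = 0.
Proof.
move=> h1; elim: k n => [|k IH] [|n] nk //; rewrite ?(eqP (arith_fun0 _))//.
rewrite exprS mulE// big_seq big1// => d; rewrite -dvdn_divisors// => dn.
have [->|d1] := eqVneq d 1%N; first by rewrite h1 mul0r.
rewrite IH ?mulr0//; have d0 := dvdn_gt0 (ltn0Sn n) dn.
have : (n.+1 %/ d < n.+1)%N by rewrite ltn_Pdiv//; lia.
lia.
Qed.

Let limE h : A :=
  mk_arith (fun n => \sum_(0 <= k < n.+1) ((k`!%:R)^-1 : C) * (h ^+ k) n).

Lemma Exp_series_cvg h : h 1%N = 0 ->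
  series (fun k => ((k`!%:R)^-1 : C) *: h ^+ k) @ \oo --> limE h.
Proof.
move=> h1; apply/cvg_ballP => e e0.
have := near_infty_natSinv_lt (PosNum e0); apply: filterS => N /= Ne.
rewrite (@ballEmdist R A)/=; apply: le_lt_trans Ne; rewrite /mdist/= /arith_dist.
set S := series _ N.
have [[-> _]|[n [n0 + ->]]] := arith_norm_witness (limE h - S).
  by rewrite invr_ge0.
move=> En; rewrite lef_pV2 ?posrE ?ltr0n// ler_nat.
rewrite leqNgt; apply: contraNN En; rewrite ltnS => nN.
rewrite addE oppE mk_arithE// /S seriesEnat sumE.
under [X in _ - X]eq_bigr do rewrite scaleE.
rewrite big_nat_recr//= expr_small// mulr0 addr0.
rewrite [X in _ - X](big_cat_nat (n := n))//=.
rewrite [X in _ - (_ + X)]big_nat_cond [X in _ - (_ + X)]big1 ?addr0 ?subrr//.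
by move=> k /andP[/andP[nk _] _]; rewrite expr_small ?mulr0.
Qed.

Lemma Exp_seriesE h n : h 1%N = 0 -> (0 < n)%N ->
  Exp_series h n = \sum_(0 <= k < n.+1) ((k`!%:R)^-1 : C) * (h ^+ k) n.
Proof.
move=> h1 n0; rewrite Exp_series.unlock (cvg_lim _ (Exp_series_cvg h1)) ?mk_arithE//.
exact: metric_hausdorff.
Qed.

Let agree n u w := forall m, (m < n)%N -> u m = w m.

Let agree_expr n u w k : agree n u w -> agree n (u ^+ k) (w ^+ k).
Proof.
move=> uw; elim: k => [|k IH] // [|m] mn; first by rewrite !(eqP (arith_fun0 _)).
rewrite !exprS !mulE// big_seq [RHS]big_seq; apply: eq_bigr => d.
rewrite -dvdn_divisors// => dm; have := dvdn_leq (ltn0Sn m) dm => dm'.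
by rewrite uw ?IH//; have := leq_div m.+1 d; lia.
Qed.

Let agree_expr2 n u w k : u 1%N = 0 -> w 1%N = 0 -> agree n u w ->
  (u ^+ k.+2) n = (w ^+ k.+2) n.
Proof.
case: n => [|n] u1 w1 uw; first by rewrite !(eqP (arith_fun0 _)).
rewrite exprS [in RHS]exprS !mulE// big_seq [RHS]big_seq; apply: eq_bigr => d.
rewrite -dvdn_divisors// => dn.
have d0 := dvdn_gt0 (ltn0Sn n) dn; have dle := dvdn_leq (ltn0Sn n) dn.
have [->|d1] := eqVneq d 1%N; first by rewrite u1 w1 !mul0r.
have [->|dn1] := eqVneq d n.+1.
  by rewrite divnn/= !expr_small ?mulr0.
rewrite uw ?(agree_expr _ uw)//; last by lia.
by rewrite ltn_Pdiv//; lia.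
Qed.

Lemma Exp_series_step n u w : u 1%N = 0 -> w 1%N = 0 -> (0 < n)%N ->
  agree n u w -> Exp_series u n - u n = Exp_series w n - w n.
Proof.
move=> u1 w1; case: n => // -[|n] _ uw.
  by rewrite !Exp_seriesE// !big_nat_recl// !big_geq// !expr1 !expr0 u1 w1.
rewrite !Exp_seriesE// !big_nat_recl// !expr0 !expr1 !invr1 !mul1r.
rewrite addrC addrCA addKr [RHS]addrC [RHS]addrCA addKr.
rewrite (agree_expr2 _ u1 w1 uw); congr (_ + (_ + _)).
by apply: eq_bigr => k _; rewrite (agree_expr2 _ u1 w1 uw).
Qed.

Lemma Exp_series_uniq N u w : u 1%N = 0 -> w 1%N = 0 ->
  (forall m, (0 < m <= N)%N -> Exp_series u m = Exp_series w m) ->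
  forall m, (m <= N)%N -> u m = w m.
Proof.
move=> u1 w1 E; elim/ltn_ind => -[|m] IH mN; first by rewrite !(eqP (arith_fun0 _)).
have ag : agree m.+1 u w by move=> k km; apply: IH => //; lia.
have := Exp_series_step u1 w1 (ltn0Sn m) ag; rewrite E//.
by move=> /addrI /oppr_inj.
Qed.

Lemma Exp_series_1 u : u 1%N = 0 -> Exp_series u 1%N = 1.
Proof.
move=> u1; rewrite Exp_seriesE// !big_nat_recl// big_geq// expr1 expr0 u1 oneE.
by rewrite mulr0 !addr0 invr1 mulr1.
Qed.

Let Exp_series_approx g : g 1%N = 1 -> forall N, exists u, u 1%N = 0 /\
  forall m, (0 < m <= N)%N -> Exp_series u m = g m.
Proof.
move=> g1; elim=> [|[|N] [u [u1 IH]]].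
- by exists 0; split=> // -[].
- exists 0; split=> // -[|[]]// _; rewrite g1; exact: Exp_series_1.
pose c := g N.+2 - Exp_series u N.+2.
pose w := u + mk_arith (fun n => (n == N.+2)%:R * c).
have w1 : w 1%N = 0 by rewrite addE mk_arithE//= u1 mul0r addr0.
have ag : agree N.+2 w u.
  move=> [|m] mN; first by rewrite !(eqP (arith_fun0 _)).
  by rewrite addE mk_arithE// ltn_eqF// mul0r addr0.
exists w; split=> // m /andP[m0 mN].
have agm : agree m w u by move=> k km; apply: ag; lia.
have /eqP := Exp_series_step w1 u1 m0 agm.
rewrite subr_eq => /eqP ->; move: mN; rewrite leq_eqVlt => /orP[/eqP->|mN].
  by rewrite addE mk_arithE// eqxx mul1r addrA subrK addrC /c subrK.
by rewrite ag// subrK IH//; lia.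
Qed.

Lemma Exp_series_surj g : g 1%N = 1 -> exists2 u : A, u 1%N = 0 & Exp_series u = g.
Proof.
move=> g1; have /choice[U HU] := Exp_series_approx g1.
pose u := mk_arith (fun n => U n n).
have u1 : u 1%N = 0 by rewrite mk_arithE//; case: (HU 1%N).
exists u => //; apply/arithP => n n0; have [Un1 Un] := HU n.
have uU m : (m <= n)%N -> u m = U n m.
  case: m => [|m] mn; first by rewrite !(eqP (arith_fun0 _)).
  rewrite mk_arithE//; have [Um1 Um] := HU m.+1.
  refine (@Exp_series_uniq m.+1 _ _ Um1 Un1 _ _ (leqnn _)) => k /andP[k0 km].
  by rewrite Um ?Un ?k0 ?km ?(leq_trans km mn).
have ag : agree n u (U n) by move=> m mn; apply: uU; lia.
have := Exp_series_step u1 Un1 n0 ag; rewrite uU// => /addIr ->.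
by rewrite Un// n0 leqnn.
Qed.

Let algE (a : C) u n : (a%:A * u) n = a * u n.
Proof. by rewrite mulr_algl scaleE. Qed.

Let sub1 f : (f - (f 1%N)%:A) 1%N = 0.
Proof. by rewrite addE oppE scaleE oneE mulr1 subrr. Qed.

Lemma Exp_1 f : Exp f 1%N = cexp (f 1%N).
Proof. by rewrite algE Exp_series_1 ?mulr1// sub1. Qed.

Lemma cexp_real (x : R) : cexp x%:C = (expR x)%:C.
Proof. by rewrite /cexp/= sin0 cos0 mulr1 mulr0. Qed.

Let realE f : arith_real f -> exists x : R, f 1%N = x%:C.
Proof. by move=> /= /complex_realP. Qed.

Let posE f : arith_pos f <-> exists2 x : R, 0 < x & f 1%N = x%:C.
Proof.
split=> [fp|[x x0 fx]]; last by rewrite /arith_pos/= fx ltcR.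
have [x fx] : exists x : R, f 1%N = x%:C by apply: realE; exact: gtr0_real fp.
by exists x => //; move: fp; rewrite /arith_pos/= fx ltcR.
Qed.

Lemma Exp_bij : set_bij (@arith_real R) (@arith_pos R) (@Exp R).
Proof.
split.
- move=> f /realE[x fx]; apply: (posE _).2; exists (expR x); first exact: expR_gt0.
  by rewrite Exp_1 fx cexp_real.
- move=> f g; rewrite !inE => /realE[x fx] /realE[y gy] fg.
  have xy : x = y.
    have : Exp f 1%N = Exp g 1%N by rewrite fg.
    rewrite (Exp_1 f).
    rewrite (Exp_1 g).
    rewrite fx gy.
    rewrite (cexp_real x).
    rewrite  (cexp_real y).
    move=> /complexI.
    exact: expR_inj.
  have fg1 : f 1%N = g 1%N by rewrite fx gy xy.
  have e0 : cexp (f 1%N) != 0.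
    by rewrite fx cexp_real fmorph_eq0 gt_eqF ?expR_gt0.
  apply/(addIr (- (f 1%N)%:A)); rewrite [in RHS]fg1; apply/arithP => n n0.
  apply: (@Exp_series_uniq n); rewrite ?sub1// => m /andP[m0 _].
  have : Exp f m = Exp g m by rewrite fg.
  by rewrite [LHS]algE [RHS]algE -fg1 => /(mulfI e0).
- move=> g /posE[y y0 gy].
  have yC0 : y%:C != 0 by rewrite fmorph_eq0 gt_eqF.
  have [|u u1 ug] := @Exp_series_surj (y%:C^-1 *: g).
    by rewrite scaleE gy mulVf.
  have v1 : ((ln y)%:C%:A + u) 1%N = (ln y)%:C.
    by rewrite addE scaleE oneE mulr1 u1 addr0.
  exists ((ln y)%:C%:A + u).
    by rewrite /arith_real/= v1; apply/complex_realP; exists (ln y).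
  rewrite /Exp v1 addrC addKr ug cexp_real lnK ?posrE//.
  by rewrite mulr_algl scalerA mulfV// scale1r.
Qed.

Lemma Log_bij : set_bij (@arith_pos R) (@arith_real R) (@Log R).
Proof. exact/bijpinv_bij/Exp_bij. Qed.

Lemma LogK f : arith_pos f -> Exp (Log f) = f.
Proof.
by case: Exp_bij => _ _ sExp fp; rewrite (surjpK _ sExp)// inE.
Qed.

Lemma Log_depthP (W : set A) : W !=set0 -> Log_depth_spec W (Log_depth W).
Proof.
move=> [f Wf]; suff : exists k, Log_depth_spec W k by exact: xgetPex.
have [b fb] : exists b, forall k, Log_defined k f -> (k <= b)%N.
  pose r j := complex.Re (iter j (@Log R) f 1%N).
  exists (Num.bound `|r 0%N|) => k fk.
  have rj j : (j < k)%N -> r j <= r 0%N - j%:R /\ 0 < r j.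
    elim: j => [|j IH] jk.
      by rewrite subr0; split=> //; have /posE[x x0] := fk _ jk; rewrite /r => ->.
    have [rj rj0] := IH (ltnW jk).
    have /posE[x x0 fx] := fk _ (ltnW jk).
    have /posE[y y0 fy] := fk _ jk.
    have xy : x = expR y.
      apply: complexI; rewrite -fx -(LogK (fk _ (ltnW jk))) Exp_1 -cexp_real.
      by rewrite -fy.
    have := expR_ge1Dx y; move: rj rj0; rewrite /r fx fy /= -xy.
    split=> //; rewrite -natr1; lra.
  rewrite leqNgt; apply/negP => bk; have [] := rj _ bk.
  move=> rb rb0; have := lt_le_trans rb0 rb; rewrite subr_gt0 ltNge.
  move/negP; apply; apply/ltW/(le_lt_trans (ler_norm _)).
  by apply: archi_boundP.
have ex : exists k, `[< forall g, W g -> Log_defined k g >].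
  by exists 0%N; apply/asboolP.
have ub k : `[< forall g, W g -> Log_defined k g >] -> (k <= b)%N.
  by move=> /asboolP /(_ f Wf); exact: fb.
have [k /asboolP kW kmax] := ex_maxnP ex ub.
by exists k; split=> // j Wj; apply: kmax; apply/asboolP.
Qed.

End ExpBijective.

Definition prime_support (S : set nat) : set nat :=
  [set p | prime p /\ exists2 n, S n & (p %| n)%N].

Definition generated_subalg (K : pzRingType) (V : lalgType K) (G : set V) : set V :=
  smallest (fun S : set V => GRing.subalg_closed [pred x | x \in S]) G.

(* [B] is meant to be a subring of [V]. *)
Definition alg_independent (V : comNzRingType) (B S : set V) : Prop :=
  forall (n : nat) (x : 'I_n -> V), injective x -> (forall i, S (x i)) ->
  forall p : mpoly n V, (forall m, B (mcoeff m p)) -> meval x p = 0 -> p = 0.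

(* Main.v *)
Require Import Defs.
From mathcomp Require Import all_boot all_order all_algebra.
From mathcomp Require Import all_classical all_reals all_analysis.
From HB Require Import structures.
From mathcomp Require Import complex.
From mathcomp Require Import -(notations) mpoly.
From mathcomp Require Import ring zify.

(** Choose a prime p that divides a member of supp f but no member of any
    supp (g i).  The map D h : n |-> logn p n * h n is a derivation of the
    integral domain of arithmetic functions; it kills exactly the functions
    whose support consists of integers prime to p, hence all of the subalgebra
    generated by the g i, and it satisfies D (Exp h) = Exp h * D h.  If k is
    the depth of f, then Exp^* {f} consists of the iterates
    e 0 = Log^k f, e (n+1) = Exp (e n), and D (e 0) != 0, for otherwise
    D f = 0.  So the theorem is a case of the following fact: in an integral
    domain of characteristic 0 with a derivation D, if D (e 0) != 0, every
    e (n+1) is nonzero and D (e (n+1)) = e (n+1) * D (e n), then the e n are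
    algebraically independent over any subring K 0 on which D vanishes.

    Put K (n+1) = K n [e n] and t = D (e 0).  Since D (e n) = t * r n with
    r n = e 1 * ... * e n, the operator D / t preserves every K n; working with
    it instead of D keeps all computations inside the tower and avoids the
    fraction field.  Two statements are proved by a joint induction.

    - e n is transcendental over K n [exp_transcendental].  A relation of
      minimal degree d for e (n+1), differentiated, gives another relation of
      degree at most d, and eliminating the leading term must yield 0.  If a is
      its constant term and b its leading coefficient, this says that a / b
      solves D x = d * D (e n) * x.

    - That equation has no nonzero solution in the fractions of
      K (n+1) = K n [e n] [no_exp_solution_adjoin].  By the previous statement
      elements of K (n+1) have a well-defined degree in e n.
      For n > 0, D / t does not raise the degree in e n, while D (e n) / t has
      degree 1; for n = 0, D / t lowers the degree, while D (e 0) / t = 1.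
      Either way the two sides of b * D a - a * D b = d * D (e n) * a * b have
      different degrees.

    Finally, transcendence at each level of the tower gives linear
    independence of the monomials in the e n [tower_free], and thus algebraic
    independence [tower_alg_independent]. *)

Set Implicit Arguments.
Unset Strict Implicit.
Unset Printing Implicit Defensive.

Import Order.TTheory GRing.Theory Num.Theory.

Local Open Scope classical_set_scope.

(** * Towers of transcendental elements *)

Section Transcendence.
Local Open Scope ring_scope.

Definition transcendental (V : nzRingType) (S : {pred V}) (x : V) :=
  forall q : {poly V}, q \is a polyOver S -> q.[x] = 0 -> q = 0.

Definition adjoin (V : nzRingType) (S : {pred V}) (x : V) : {pred V} :=
  [pred y | `[< exists2 q : {poly V}, q \is a polyOver S & y = q.[x] >]].

Lemma adjoinP (V : nzRingType) (S : {pred V}) (x y : V) :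
  reflect (exists2 q : {poly V}, q \is a polyOver S & y = q.[x])
          (y \in adjoin S x).
Proof. exact: asboolP. Qed.

Lemma adjoin_subring_closed (V : comNzRingType) (S : subringClosed V) (x : V) :
  GRing.subring_closed (adjoin S x).
Proof.
split=> [|_ _ /adjoinP[p pS ->] /adjoinP[q qS ->]|
          _ _ /adjoinP[p pS ->] /adjoinP[q qS ->]]; apply/adjoinP.
- by exists 1%:P; rewrite ?polyOverC ?rpred1 ?hornerC.
- by exists (p - q); rewrite ?rpredB ?hornerD ?hornerN.
- by exists (p * q); rewrite ?rpredM ?hornerM.
Qed.

HB.instance Definition _ (V : comNzRingType) (S : subringClosed V) (x : V) :=
  GRing.isSubringClosed.Build V (adjoin S x) (adjoin_subring_closed S x).

Lemma sub_adjoin (V : nzRingType) (S : subringClosed V) (x y : V) :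
  y \in S -> y \in adjoin S x.
Proof. by move=> yS; apply/adjoinP; exists y%:P; rewrite ?polyOverC ?hornerC. Qed.

Lemma mem_adjoin (V : nzRingType) (S : subringClosed V) (x : V) :
  x \in adjoin S x.
Proof. by apply/adjoinP; exists 'X; rewrite ?polyOverX ?hornerX. Qed.

Variables (V : comNzRingType) (K0 : subringClosed V) (e : nat -> V).

Fixpoint tower n : subringClosed V :=
  if n is m.+1 then adjoin (tower m) (e m) else K0.

Lemma tower_mono m n x : (m <= n)%N -> x \in tower m -> x \in tower n.
Proof.
elim: n => [|n IH]; first by rewrite leqn0 => /eqP->.
rewrite leq_eqVlt => /orP[/eqP-> //|mn] xm; exact/sub_adjoin/IH.
Qed.

Lemma mem_tower i n : (i < n)%N -> e i \in tower n.
Proof. by move=> i_lt; apply: (tower_mono i_lt); apply: mem_adjoin. Qed.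

(** Induction on the number of generators: collecting the terms according to
    the exponent of the last generator gives a polynomial relation for it over
    the previous level, so each collected coefficient vanishes, and it is a
    combination of monomials in fewer generators.  Monomials are indexed by an
    arbitrary type so that the family collected at one exponent is again of
    the same kind. *)
Lemma tower_free : (forall n, transcendental (tower n) (e n)) ->
  forall N (J : eqType) (s : seq J) (mon : J -> nat -> nat) (b : J -> V),
  uniq s ->
  {in s &, forall u v, (forall i, (i < N)%N -> mon u i = mon v i) -> u = v} ->
  {in s, forall u, b u \in K0} ->
  \sum_(u <- s) b u * \prod_(i < N) e i ^+ mon u i = 0 ->
  {in s, forall u, b u = 0}.
Proof.
move=> e_tr; elim=> [|N IH] J s mon b s_uniq s_inj bK sum0 u us.
  have sE : s = [:: u].
    case: s s_uniq s_inj us {sum0 bK} => [|v s] //= /andP[vs _] s_inj us.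
    have {us} -> : u = v by apply: s_inj; rewrite ?mem_head.
    case: s vs s_inj => [|w s] //= vs s_inj.
    by move: vs; rewrite (s_inj v w) ?mem_head ?inE ?eqxx ?orbT.
  by move: sum0; rewrite sE big_seq1 big_ord0 mulr1.
pose c v := b v * \prod_(i < N) e i ^+ mon v i.
pose q := \sum_(v <- s) c v *: 'X^(mon v N).
have cK v : v \in s -> c v \in tower N.
  move=> vs; apply: rpredM; first exact/(tower_mono (leq0n N))/bK.
  by apply: rpred_prod => i _; rewrite rpredX// mem_tower.
have q0 : q = 0.
  apply: (e_tr N).
    rewrite /q big_seq; apply: rpred_sum => v vs.
    by rewrite polyOverZ ?polyOverXn ?cK.
  rewrite horner_sum -[in RHS]sum0; apply: eq_bigr => v _.
  by rewrite hornerZ hornerXn /c big_ord_recr/= mulrA.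
apply: (IH _ [seq v <- s | mon v N == mon u N] mon b).
- exact: filter_uniq.
- move=> v w; rewrite !mem_filter => /andP[/eqP vN vs] /andP[/eqP wN ws] vw.
  apply: s_inj => // i; rewrite ltnS leq_eqVlt => /orP[/eqP->|]; last exact: vw.
  by rewrite vN wN.
- by move=> v; rewrite mem_filter => /andP[_]; exact: bK.
- have := congr1 (fun p : {poly V} => p`_(mon u N)) q0.
  rewrite /= coef0 coef_sum => coef_q0.
  rewrite big_filter big_mkcond/= -[RHS]coef_q0; apply: eq_bigr => v _.
  by rewrite coefZ coefXn eq_sym; case: eqP; rewrite ?mulr1 ?mulr0.
- by rewrite mem_filter eqxx.
Qed.

(** The points at which a polynomial is evaluated are some of the [e k], in any
    order; the exponent family [mon] below records a monomial in them as a
    monomial in the initial segment of the [e k] containing them all. *)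
Lemma tower_alg_independent : (forall n, transcendental (tower n) (e n)) ->
  forall B : set V, B `<=` [set` K0] -> alg_independent B (range e).
Proof.
move=> e_tr B BK n x x_inj xe p pB; rewrite mevalE => p0.
have /choice[j xj] : forall i, exists k, x i = e k.
  by move=> i; have [k _ <-] := xe i; exists k.
have j_inj : injective j by move=> i k jik; apply: x_inj; rewrite !xj jik.
pose N := (\max_i j i).+1.
have jN i : (j i < N)%N by rewrite ltnS; exact: (leq_bigmax i).
pose mon (m : multinom n) (k : nat) := \sum_(i < n | j i == k) m i.
have mon_j m i : mon m (j i) = m i.
  by rewrite /mon (big_pred1 i)// => k; rewrite (inj_eq j_inj).
apply/mpolyP => m; rewrite mcoeff0.
have [mp|/memN_msupp_eq0 //] := boolP (m \in msupp p).
apply: (@tower_free e_tr N _ (msupp p) mon (fun m => mcoeff m p)) mp.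
- exact: msupp_uniq.
- move=> u v _ _ uv; apply/mnmP => i; rewrite -!mon_j; exact: uv.
- by move=> u _; apply: BK; apply: pB.
- rewrite -[RHS]p0; apply: eq_bigr => u _; congr (_ * _).
  rewrite [RHS](eq_bigr (fun i => e (j i) ^+ u i)); last first.
    by move=> i _; rewrite xj.
  rewrite (partition_big (fun i => Ordinal (jN i)) predT)//=.
  apply: eq_bigr => k _; rewrite /mon expr_sum; apply: congr_big => // i.
  by move=> /eqP->.
Qed.
End Transcendence.

(** * Transcendence of iterated exponentials in a differential domain *)

Section DifferentialTranscendence.
Local Open Scope ring_scope.
Variables (V : idomainType) (D : {additive V -> V}).
Hypothesis D_leibniz : forall x y, D (x * y) = D x * y + x * D y.
Hypothesis char0 : [pchar V] =i pred0.
Implicit Types (S : subringClosed V) (t x e : V) (p q : {poly V}).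

Lemma derivation_horner q x :
  D q.[x] = (map_poly D q).[x] + D x * q^`().[x].
Proof.
elim/poly_ind: q => [|q c IH].
  by rewrite deriv0 map_poly0 !horner0 raddf0; ring.
have -> : map_poly D (q * 'X + c%:P) = map_poly D q * 'X + (D c)%:P.
  apply/polyP => i; rewrite coef_map !coefD !coefMX !coefC raddfD/=.
  by case: i => [|i]; rewrite /= ?raddf0 ?coef_map.
rewrite derivMXaddC !hornerE raddfD/= D_leibniz IH; ring.
Qed.

(** Stability of S under the derivation D / t of the fraction field, stated
    inside the domain. *)
Definition scaled_stable S t :=
  {in S, forall a, exists2 a', a' \in S & D a = t * a'}.

Lemma map_derivation_scaled S t q : scaled_stable S t -> q \is a polyOver S ->
  exists2 q', q' \is a polyOver S & map_poly D q = t *: q'.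
Proof.
move=> St /polyOverP qS.
have /choice[c cP] : forall i, exists a, a \in S /\ D q`_i = t * a.
  by move=> i; have [a aS Da] := St _ (qS i); exists a.
exists (\poly_(i < size q) c i); first by apply: polyOver_poly => i _; case: (cP i).
apply/polyP => i; rewrite coef_map coefZ coef_poly; case: ltnP => iq.
  by case: (cP i).
by rewrite nth_default// raddf0 mulr0.
Qed.

(** The chain rule for D / t: [C] is the value of D / t at [e], written as a
    polynomial in [e]. *)
Lemma derivation_horner_scaled S t e q C : scaled_stable S t ->
    q \is a polyOver S -> C \is a polyOver S -> D e = t * C.[e] ->
  exists q', [/\ q' \is a polyOver S, D q.[e] = t * (q' + C * q^`()).[e] &
    map_poly D q = t *: q'].
Proof.
move=> St qS CS De; have [q' q'S Dq] := map_derivation_scaled St qS.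
by exists q'; split=> //; rewrite derivation_horner Dq De !hornerE; ring.
Qed.

Lemma scaled_stable_adjoin S t e C : scaled_stable S t ->
  C \is a polyOver S -> D e = t * C.[e] ->
  scaled_stable [the subringClosed V of adjoin S e] t.
Proof.
move=> St CS De _ /adjoinP[q qS ->].
have [q' [q'S -> _]] := derivation_horner_scaled St qS CS De.
exists (q' + C * q^`()).[e] => //; apply/adjoinP; exists (q' + C * q^`()) => //.
by rewrite rpredD ?rpredM ?polyOver_deriv.
Qed.

(** With x = a / b, the forbidden equation is D x = d t x, which would be
    solved by the d-th power of an exponential of an antiderivative of t. *)
Definition no_exp_solution S t :=
  forall a b d, a \in S -> b \in S -> a != 0 -> b != 0 -> (0 < d)%N ->
  b * D a - a * D b != t * a * b *+ d.

Lemma natr_neq0 d : (0 < d)%N -> d%:R != 0 :> V.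
Proof. by move=> d0; rewrite ((pcharf0P V).1 char0) -lt0n. Qed.

(** With D / t in place of D, the equation for a = p(e) and b = q(e) lifts to
    polynomials because e is transcendental.  The hypothesis on sizes says that
    D / t raises degrees by less than deg C, so the right-hand side C p q has
    larger degree than the left-hand side. *)
Lemma no_exp_solution_adjoin S t e C : t != 0 -> transcendental S e ->
    C \is a polyOver S -> C != 0 ->
    (forall q, q \is a polyOver S -> q != 0 ->
      exists q', [/\ q' \is a polyOver S, ((size q').+1 < size C + size q)%N &
                     D q.[e] = t * q'.[e]]) ->
  no_exp_solution [the subringClosed V of adjoin S e] (t * C.[e]).
Proof.
move=> t0 e_tr CS C0 DS a b d /adjoinP[p pS ->] /adjoinP[q qS ->] pe0 qe0 d0.
have p0 : p != 0 by apply: contra_neq pe0 => ->; rewrite horner0.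
have q0 : q != 0 by apply: contra_neq qe0 => ->; rewrite horner0.
have [p' [p'S p's ->]] := DS p pS p0; have [q' [q'S q's ->]] := DS q qS q0.
apply/eqP => E.
have Z : q * p' - p * q' - C * p * q *+ d = 0.
  apply: e_tr; first by rewrite !(rpredB, rpredM, rpredMn).
  apply: (mulfI t0); rewrite mulr0 hornerD hornerN hornerMn mulrBr mulrnAr.
  have -> : t * (C * p * q).[e] = t * C.[e] * p.[e] * q.[e].
    by rewrite !hornerM; ring.
  by rewrite -E hornerD hornerN !hornerM; ring.
have : (size (C * p * q *+ d) <= size (q * p' - p * q')%R)%N.
  by move/eqP: Z; rewrite subr_eq0 => /eqP ->.
rewrite leqNgt => /negP; apply.
rewrite -scaler_nat size_scale ?natr_neq0// !size_mul ?mulf_neq0//.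
apply: leq_ltn_trans (size_polyD _ _) _; rewrite size_polyN gtn_max.
rewrite -size_poly_gt0 in p0; rewrite -size_poly_gt0 in q0.
rewrite -size_poly_gt0 in C0.
apply/andP; split; apply: leq_ltn_trans (size_polyMleq _ _) _.
  by move: p's p0 q0; move: (size p) (size q) (size C) (size p') => ? ? ? ?; lia.
by move: q's p0 q0; move: (size p) (size q) (size C) (size q') => ? ? ? ?; lia.
Qed.

(** Take a relation q of least degree d for e.  Its constant term is nonzero
    because e is.  The i-th coefficient of its image r under D / t involves
    only q_i, as D multiplies e ^ i by i t w: thus q_d r - r_d q is a relation of smaller
    degree, and comparing constant terms gives the equation excluded by the
    hypothesis on S. *)
Lemma exp_transcendental S e t w :
  t != 0 -> e != 0 -> scaled_stable S t -> w \in S ->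
  D e = t * w * e -> no_exp_solution S (t * w) -> transcendental S e.
Proof.
move=> t0 e0 St wS De H q.
have [n] := ubnP (size q); elim: n q => // n IH q; rewrite ltnS => qn qS qe.
have [->//|q0] := eqVneq q 0.
(* a zero constant term lets one factor out [e] *)
have [qc0|qc0] := eqVneq q`_0 0.
  have qX : q = drop_poly 1 q * 'X.
    by apply/polyP => -[|i]; rewrite coefMX ?qc0// coef_drop_poly addn1.
  rewrite qX (IH (drop_poly 1 q)) ?mul0r//.
  - by rewrite size_drop_poly; move: q0; rewrite -size_poly_gt0; lia.
  - by apply/polyOverP => i; rewrite coef_drop_poly; exact/polyOverP.
  - by apply: (mulIf e0); rewrite mul0r -[X in _ * X]hornerX -hornerM -qX.
have CS : w *: 'X \is a polyOver S by rewrite polyOverZ ?polyOverX.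
have DeC : D e = t * (w *: 'X).[e] by rewrite De hornerZ hornerX mulrA.
have [q' [q'S Dq Dq']] := derivation_horner_scaled St qS CS DeC.
set r := q' + _ in Dq.
have rS : r \is a polyOver S by rewrite rpredD ?rpredM ?polyOver_deriv.
have re : r.[e] = 0 by apply: (mulfI t0); rewrite -Dq qe raddf0 mulr0.
have r_coef i : t * r`_i = D q`_i + t * w * q`_i *+ i.
  rewrite /r coefD mulrDr -coefZ -Dq' coef_map; congr (_ + _).
  rewrite -scalerAl coefZ coefXM; case: i => [|i] /=; first by rewrite !mulr0 mulr0n.
  by rewrite coef_deriv -mulrnAr mulrA.
pose d := (size q).-1; have sq : size q = d.+1.
  by rewrite /d prednK// size_poly_gt0.
have r_size : (size r <= d.+1)%N.
  apply/leq_sizeP => i di; apply: (mulfI t0).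
  by rewrite r_coef nth_default ?sq// !mulr0 raddf0 mul0rn addr0.
have qd0 : q`_d != 0 by rewrite -lead_coefE lead_coef_eq0.
have s0 : q`_d *: r - r`_d *: q = 0.
  apply: IH.
  - apply: leq_trans qn; rewrite sq ltnS; apply/leq_sizeP => i.
    rewrite leq_eqVlt coefB !coefZ => /orP[/eqP<-|di].
      by rewrite mulrC subrr.
    rewrite [r`_i]nth_default ?(leq_trans r_size)//.
    by rewrite [q`_i]nth_default ?sq// !mulr0 subr0.
  - by rewrite rpredB ?polyOverZ//; exact/polyOverP.
  - by rewrite hornerD hornerN !hornerZ qe re !mulr0 subrr.
have [d0|d0] := posnP d.
  have qC : q = (q`_0)%:P by apply: size1_polyC; rewrite sq d0.
  by move: qe; rewrite qC hornerC => /eqP; rewrite (negbTE qc0).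
have qK i : q`_i \in S by exact/polyOverP.
have /eqP[] := H q`_0 q`_d d (qK _) (qK _) qc0 qd0 d0.
move/(congr1 (fun p : {poly V} => p`_0)): s0.
rewrite coefB !coefZ coef0 => /(congr1 ( *%R t)).
rewrite mulr0 mulrBr mulrCA [X in _ - X]mulrA !r_coef mulr0n addr0 => E.
move/eqP: E; rewrite subr_eq0 => /eqP ->.
by rewrite mulrDl mulrnAl [D _ * _]mulrC addrAC subrr add0r mulrAC.
Qed.

Section ExpTower.
Variables (K0 : subringClosed V) (e : nat -> V).
Hypothesis D_K0 : {in K0, forall a, D a = 0}.
Hypothesis De0 : D (e 0%N) != 0.
Hypothesis e_neq0 : forall n, e n.+1 != 0.
Hypothesis De : forall n, D (e n.+1) = e n.+1 * D (e n).

Let t := D (e 0%N).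
Let r n := \prod_(i < n) e i.+1.
Let K := tower K0 e.
(** The value of D / t at [e n], as a polynomial in [e n]. *)
Let C n : {poly V} := if n is m.+1 then r m *: 'X else 1.

Let DeC n : D (e n) = t * (C n).[e n].
Proof.
elim: n => [|n IH]; first by rewrite hornerC mulr1.
rewrite De IH; case: n {IH} => [|n] /=.
  by rewrite /r big_ord0 hornerZ hornerX hornerC !mulr1 mul1r mulrC.
by rewrite /r big_ord_recr/= !hornerZ !hornerX; ring.
Qed.

Let C_K n : C n \is a polyOver (K n).
Proof.
case: n => [|n] /=; first exact: rpred1.
rewrite polyOverZ ?polyOverX//; apply: rpred_prod => i _.
exact: (@mem_tower _ K0 e i.+1 n.+1 (ltn_ord i)).
Qed.

Let r_neq0 n : r n != 0.
Proof. by apply/prodf_neq0 => i _. Qed.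

Let C_neq0 n : C n != 0.
Proof.
case: n => [|n] /=; first exact: oner_neq0.
by rewrite -size_poly_gt0 size_scale ?r_neq0// size_polyX.
Qed.

Let K_stable n : scaled_stable (K n) t.
Proof.
elim: n => [a aK|n IH] /=; first by exists 0; rewrite ?rpred0 ?mulr0 ?D_K0.
exact: (scaled_stable_adjoin IH (C_K n) (DeC n)).
Qed.

Let K_no_exp n :
  transcendental (K n) (e n) -> no_exp_solution (K n.+1) (D (e n)).
Proof.
move=> e_tr; rewrite DeC; apply: no_exp_solution_adjoin => // q qK q0.
have q_gt0 : (0 < size q)%N by rewrite size_poly_gt0.
have [q' [q'K Dq Dq']] := derivation_horner_scaled (@K_stable n) qK (C_K n) (DeC n).
exists (q' + C n * q^`()); split=> //.
  by rewrite rpredD ?rpredM ?polyOver_deriv// C_K.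
have q'_size : (size q' <= size q)%N.
  by rewrite -(size_scale _ De0) -Dq' size_poly.
have dq_size := lt_size_deriv q0.
apply: leq_ltn_trans (_ : (maxn (size q') (size (C n * q^`())%R)).+1 < _)%N.
  by rewrite ltnS size_polyD.
rewrite -maxnSS gtn_max.
case: n {e_tr Dq} q'K qK Dq' q'_size => [|n] /= q'K qK Dq' q'_size.
  have -> : q' = 0.
    apply/eqP; rewrite -size_poly_eq0 -(size_scale _ De0) -Dq' size_poly_eq0.
    apply/eqP/polyP => i.
    by rewrite coef_map coef0 D_K0//; exact/polyOverP.
  by rewrite size_poly0 size_poly1 mul1r !add1n !ltnS q_gt0.
have rX_size : size (r n *: 'X) = 2 by rewrite size_scale ?r_neq0// size_polyX.
have C_size : (size (r n *: 'X * q^`())%R <= size q)%N.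
  by apply: leq_trans (size_polyMleq _ _) _; rewrite rX_size.
by rewrite rX_size !addSn add0n !ltnS q'_size.
Qed.

(** For the first level, D / t differentiates a relation for e 0 formally, so a
    relation of least degree has zero derivative and is constant. *)
Lemma exp_tower_transcendental n : transcendental (K n) (e n).
Proof.
elim: n => [q|n IH].
  have [n] := ubnP (size q); elim: n q => // n IH q; rewrite ltnS => qn qK qe.
  have [->//|q0] := eqVneq q 0.
  have dq : q^`() = 0.
    apply: IH; first exact: leq_trans (lt_size_deriv q0) qn.
      exact: polyOver_deriv.
    apply: (mulfI De0); rewrite mulr0.
    have := derivation_horner q (e 0%N); rewrite qe raddf0.
    have -> : map_poly D q = 0.
      by apply/polyP => i; rewrite coef_map coef0 D_K0//; exact/polyOverP.
    by rewrite horner0 add0r => <-.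
  have qC : q = (q`_0)%:P.
    apply/polyP => -[|i]; rewrite coefC//=.
    have /eqP := congr1 (fun p : {poly V} => p`_i) dq.
    rewrite /= coef_deriv coef0 -mulr_natr mulf_eq0.
    by rewrite (negbTE (natr_neq0 _))// orbF => /eqP.
  by move: qe; rewrite qC hornerC => ->.
have wK : (C n).[e n] \in K n.+1 by apply/adjoinP; exists (C n) => //; exact: C_K.
apply: (@exp_transcendental _ _ t _ De0 (e_neq0 n) (@K_stable n.+1) wK).
  by rewrite De DeC mulrC.
by rewrite -DeC; apply: K_no_exp.
Qed.
End ExpTower.
End DifferentialTranscendence.

(** * The domain of arithmetic functions and its logarithmic derivations *)

Section ArithmeticFunctions.
Local Open Scope ring_scope.
Local Open Scope complex_scope.
Variable R : realType.
Local Notation A := (arith R).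
Implicit Types (f g h u : A) (p n : nat).

Lemma arith0E f : f 0%N = 0.
Proof. exact/eqP/arith_fun0. Qed.

Lemma arith_mulE f g n : (0 < n)%N ->
  (f * g) n = \sum_(d <- divisors n) f d * g (n %/ d)%N.
Proof. exact: arith_convE. Qed.

Lemma arith_addE f g n : (f + g) n = f n + g n.
Proof. by case: n => [|n]; [rewrite !arith0E addr0 | exact: mk_arithE]. Qed.

Lemma arith_oppE f n : (- f) n = - f n.
Proof. by case: n => [|n]; [rewrite !arith0E oppr0 | exact: mk_arithE]. Qed.

Lemma arith_scaleE (a : R[i]) f n : (a *: f) n = a * f n.
Proof. by case: n => [|n]; [rewrite !arith0E mulr0 | exact: mk_arithE]. Qed.

Lemma arith_zeroE n : (0 : A) n = 0.
Proof. by case: n => [|n]; [rewrite arith0E | exact: mk_arithE]. Qed.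

Lemma arith_oneE n : (1 : A) n = (n == 1%N)%:R.
Proof. by case: n => [|n]; [rewrite arith0E | exact: mk_arithE]. Qed.

Lemma arith_sumE (F : nat -> A) N n :
  (\sum_(0 <= k < N) F k) n = \sum_(0 <= k < N) F k n.
Proof.
exact: (big_morph (fun u : A => u n) (fun u w => arith_addE u w n)
                  (arith_zeroE n)).
Qed.

Lemma arith_neq0P f : f != 0 ->
  exists n, [/\ (0 < n)%N, f n != 0 & forall m, (m < n)%N -> f m = 0].
Proof.
move=> f0; have fn : exists n, f n != 0.
  apply: contra_notP (negP f0) => nf; apply/eqP/arithP => n _.
  by rewrite arith_zeroE; apply: contra_notP nf => /eqP ?; exists n.
exists (ex_minn fn); case: ex_minnP => n fn0 n_min; split=> //.
  by case: n fn0 {n_min} => //; rewrite arith0E eqxx.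
by move=> m mn; apply: contraTeq mn => /n_min; rewrite -leqNgt.
Qed.

(** At the product of the least elements of the two supports, only one term of
    the convolution is nonzero. *)
Lemma arith_mulf_eq0 f g : f * g = 0 -> (f == 0) || (g == 0).
Proof.
move=> fg0; apply: contraT; rewrite negb_or => /andP[/arith_neq0P[m [m0 fm mmin]]].
move=> /arith_neq0P[n [n0 gn nmin]].
have mn0 : (0 < m * n)%N by rewrite muln_gt0 m0.
have := congr1 (fun h : A => h (m * n)%N) fg0.
rewrite /= arith_mulE// arith_zeroE (bigD1_seq m)/= ?divisors_uniq//; last first.
  by rewrite -dvdn_divisors// dvdn_mulr.
rewrite mulKn// big_seq_cond big1 ?addr0 => [/eqP|d /andP[]].
  by rewrite mulf_eq0 (negbTE fm) (negbTE gn).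
rewrite -dvdn_divisors// => dmn dm.
have [dltm|mled] := ltnP d m; first by rewrite mmin ?mul0r.
rewrite [g _]nmin ?mulr0// ltn_divLR ?(leq_trans m0)// mulnC ltn_mul2l n0/=.
by rewrite ltn_neqAle eq_sym dm.
Qed.

(** An integral domain comes with a total inverse operation; here it is chosen
    classically among the convolution inverses. *)
Definition arith_unit : {pred A} := fun f => `[< exists g, g * f = 1 >].
Definition arith_inv f : A :=
  if pselect (exists g, g * f = 1) is left ex then sval (cid ex) else f.

Lemma arith_mulVf : {in arith_unit, left_inverse 1 arith_inv *%R}.
Proof.
by move=> f /asboolP ex; rewrite /arith_inv; case: pselect => // ex'; case: cid.
Qed.

Lemma arith_unitPl f g : g * f = 1 -> f \in arith_unit.
Proof. by move=> gf; apply/asboolP; exists g. Qed.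

Lemma arith_invr_out : {in [predC arith_unit], arith_inv =1 id}.
Proof.
by move=> f; rewrite inE => /asboolPn nf; rewrite /arith_inv; case: pselect.
Qed.

HB.instance Definition _ := GRing.ComNzRing_hasMulInverse.Build A
  arith_mulVf arith_unitPl arith_invr_out.

HB.instance Definition _ := GRing.ComUnitRing_isIntegral.Build A arith_mulf_eq0.

Lemma arith_pchar0 : [pchar A] =i pred0.
Proof. by move=> q; rewrite pchar_lalg pchar_num. Qed.

Definition logn_derivation p f : A := mk_arith (fun n => (logn p n)%:R * f n).

Lemma logn_derivationE p f n : logn_derivation p f n = (logn p n)%:R * f n.
Proof. by case: n => [|n]; [rewrite !arith0E mulr0 | exact: mk_arithE]. Qed.

Lemma logn_derivation_is_zmod_morphism p : zmod_morphism (logn_derivation p).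
Proof.
move=> f g; apply/arithP => n _.
by rewrite !(arith_addE, arith_oppE, logn_derivationE) mulrBr.
Qed.

HB.instance Definition _ p := GRing.isZmodMorphism.Build A A
  (logn_derivation p) (@logn_derivation_is_zmod_morphism p).

Lemma logn_derivation_leibniz p f g :
  logn_derivation p (f * g) = logn_derivation p f * g + f * logn_derivation p g.
Proof.
apply/arithP => n n0; rewrite arith_addE logn_derivationE !arith_mulE//.
rewrite mulr_sumr -big_split/= big_seq [RHS]big_seq; apply: eq_bigr => d.
rewrite -dvdn_divisors// => dn; rewrite !logn_derivationE.
have d0 := dvdn_gt0 n0 dn.
rewrite -{1}(divnK dn) lognM// ?divn_gt0 ?(dvdn_leq n0)//.
by rewrite natrD; ring.
Qed.

Lemma logn_derivationZ p (a : R[i]) f :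
  logn_derivation p (a *: f) = a *: logn_derivation p f.
Proof.
by apply/arithP => n _; rewrite !(logn_derivationE, arith_scaleE) mulrCA.
Qed.

Lemma logn_derivation1 p : logn_derivation p 1 = 0.
Proof.
apply/arithP => n _; rewrite logn_derivationE arith_oneE arith_zeroE.
by case: eqP => [->|]; rewrite ?logn1 ?mul0r ?mulr0.
Qed.

Definition logn_constants p : {pred A} := [pred f | logn_derivation p f == 0].

Lemma mem_logn_constants p f :
  (f \in logn_constants p) = (logn_derivation p f == 0).
Proof. by []. Qed.

Lemma logn_constants_subalg_closed p : GRing.subalg_closed (logn_constants p).
Proof.
split=> [|a f g|f g]; rewrite !mem_logn_constants.
    by rewrite logn_derivation1 eqxx.
  move=> /eqP f0 /eqP g0.
  by rewrite raddfD/= logn_derivationZ f0 g0 scaler0 addr0 eqxx.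
move=> /eqP f0 /eqP g0.
by rewrite logn_derivation_leibniz f0 g0 mul0r mulr0 addr0 eqxx.
Qed.

Lemma logn_constants_subring_closed p : GRing.subring_closed (logn_constants p).
Proof. exact/GRing.subalg_closedBM/logn_constants_subalg_closed. Qed.

HB.instance Definition _ p := GRing.isSubringClosed.Build A
  (logn_constants p) (logn_constants_subring_closed p).

(** In characteristic 0 the factor logn p n vanishes only for n prime to p. *)
Lemma logn_constantsP p f : prime p ->
  reflect (~ prime_support (supp f) p) (f \in logn_constants p).
Proof.
move=> pp; apply: (iffP eqP) => [f0 [_ [n fn pn]]|fp].
  have n0 : (0 < n)%N by case: n fn {pn} => //; rewrite /supp/= arith0E eqxx.
  have /eqP := congr1 (fun h : A => h n) f0.
  rewrite /= logn_derivationE arith_zeroE mulf_eq0 (negbTE fn) orbF pnatr_eq0.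
  by rewrite -leqn0 leqNgt logn_gt0 mem_primes pp n0 pn.
apply/arithP => n n0; rewrite logn_derivationE arith_zeroE.
have [->|fn] := eqVneq (f n) 0; first by rewrite mulr0.
have [pn|/negbTE pn] := boolP (p %| n)%N; first by case: fp; split=> //; exists n.
by rewrite lognE pn !andbF mul0r.
Qed.

Lemma arith_expr_small h k n : h 1%N = 0 -> (n <= k)%N -> (h ^+ k) n = 0.
Proof.
move=> h1; elim: k n => [|k IH] [|n] nk //; rewrite ?arith0E//.
rewrite exprS arith_mulE// big_seq big1// => d; rewrite -dvdn_divisors// => dn.
have [->|d1] := eqVneq d 1%N; first by rewrite h1 mul0r.
rewrite IH ?mulr0// -ltnS (leq_trans _ nk)//.
have d0 := dvdn_gt0 (ltn0Sn n) dn.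
by rewrite ltn_Pdiv// ltn_neqAle eq_sym d1.
Qed.

Let expsum u N : A := \sum_(0 <= k < N) ((k`!%:R)^-1 : R[i]) *: u ^+ k.

(** The k-th power of u vanishes on the integers up to k, so at any given point
    the exponential series is a finite sum, and D can be computed on partial
    sums. *)
Lemma Exp_series_partial u n N : u 1%N = 0 -> (n < N)%N ->
  Exp_series u n = expsum u N n.
Proof.
move=> u1 nN; case: n nN => [|n] nN; first by rewrite !arith0E.
rewrite Exp_seriesE// arith_sumE [RHS](big_cat_nat (n := n.+2))//=.
rewrite [X in _ + X]big_nat_cond [X in _ + X]big1 ?addr0 => [|k].
  by apply: eq_bigr => k _; rewrite arith_scaleE.
by move=> /andP[/andP[nk _] _]; rewrite arith_scaleE arith_expr_small ?mulr0// ltnW.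
Qed.

Lemma derivation_expsum p u N :
  logn_derivation p (expsum u N.+1) = expsum u N * logn_derivation p u.
Proof.
have expsumS M : expsum u M.+1 = expsum u M + ((M`!%:R)^-1 : R[i]) *: u ^+ M.
  by rewrite /expsum big_nat_recr.
elim: N => [|N IH].
  by rewrite /expsum big_nat1 big_geq// mul0r expr0 invr1 scale1r logn_derivation1.
rewrite expsumS raddfD/= IH [in RHS]expsumS mulrDl; congr (_ + _).
rewrite logn_derivationZ.
have -> k : logn_derivation p (u ^+ k.+1) = (u ^+ k * logn_derivation p u) *+ k.+1.
  elim: k => [|k IHk]; first by rewrite expr1 expr0 mul1r.
  by rewrite exprS logn_derivation_leibniz IHk exprS !mulrS; ring.
rewrite -[_ *+ N.+1]scaler_nat scalerA -scalerAl factS natrM invfM mulrAC.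
rewrite mulVf ?mul1r//.
Qed.

Lemma logn_derivation_Exp_series p u : u 1%N = 0 ->
  logn_derivation p (Exp_series u) = Exp_series u * logn_derivation p u.
Proof.
move=> u1; apply/arithP => n n0; rewrite arith_mulE// logn_derivationE.
have n2 : (n < n.+2)%N by rewrite ltnW.
have := congr1 (fun h : A => h n) (derivation_expsum p u n.+1).
rewrite logn_derivationE -(Exp_series_partial u1 n2) => ->.
rewrite arith_mulE// big_seq [RHS]big_seq; apply: eq_bigr => d.
rewrite -dvdn_divisors// => /(dvdn_leq n0) dn.
by have dn1 : (d < n.+1)%N by []; rewrite (Exp_series_partial u1 dn1).
Qed.

Lemma logn_derivation_Exp p f :
  logn_derivation p (Exp f) = Exp f * logn_derivation p f.
Proof.
rewrite /Exp !mulr_algl logn_derivationZ logn_derivation_Exp_series; last first.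
  by rewrite arith_addE arith_oppE arith_scaleE arith_oneE mulr1 subrr.
rewrite -scalerAl; congr (_ *: (_ * _)).
by rewrite raddfB/= logn_derivationZ logn_derivation1 scaler0 subr0.
Qed.

Lemma cexp_neq0 (z : R[i]) : cexp z != 0.
Proof.
case: z => x y; apply/eqP => -[/eqP + /eqP]; rewrite !mulf_eq0 gt_eqF ?expR_gt0//=.
move=> /eqP cy /eqP sy; have /eqP := cos2Dsin2 y.
by rewrite cy sy expr0n addr0 eq_sym oner_eq0.
Qed.

Lemma Exp_neq0 f : Exp f != 0.
Proof.
apply: contra_neq (cexp_neq0 (f 1%N)) => Ef.
by rewrite -Exp_1 Ef arith_zeroE.
Qed.

Lemma Log_iterK k f : Log_defined k f -> iter k (@Exp R) (iter k (@Log R) f) = f.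
Proof.
elim: k => // k IH kf; rewrite iterSr iterS LogK ?IH//; last exact: kf.
by move=> j jk; apply: kf; exact: ltnW.
Qed.

Definition Exp_chain f n : A :=
  iter n (@Exp R) (iter (Log_depth [set f]) (@Log R) f).

Lemma Log_depth1_defined f : Log_defined (Log_depth [set f]) f.
Proof. by have [+ _] := Log_depthP (ex_intro [set f] f erefl); exact. Qed.

Lemma Exp_star1_sub f : Exp_star [set f] `<=` range (Exp_chain f).
Proof.
move=> _ [_ [m [-> km ->]]]; have fk := @Log_depth1_defined f.
rewrite /Exp_chain; set k := Log_depth _ in km fk *.
case: m km => [m _|m mk].
  by exists (m + k)%N => //; rewrite iterD Log_iterK.
have mk' : (m.+1 <= k)%N by lia.
exists (k - m.+1)%N => //=.
rewrite -{2}(subnK mk') iterD Log_iterK// => j jk.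
by rewrite -iterD; apply: fk; lia.
Qed.

Lemma logn_derivation_Exp_iter p n h :
  logn_derivation p h = 0 -> logn_derivation p (iter n (@Exp R) h) = 0.
Proof. by move=> h0; elim: n => //= n IH; rewrite logn_derivation_Exp IH mulr0. Qed.

End ArithmeticFunctions.

Theorem theorem4p2 (R : realType) (f : arith R) (I : Type) (g : I -> arith R)
  (hfg : ~ (prime_support (supp f) `<=`
            \bigcup_(i in [set: I]) prime_support (supp (g i)))) :
  alg_independent (generated_subalg (range g)) (Exp_star [set f]).
Proof.
have [p fp gp] : exists2 p, prime_support (supp f) p &
    forall i, ~ prime_support (supp (g i)) p.
  apply: contra_notP hfg => nex p fp; apply: contra_notP nex => np.
  by exists p => // i ?; apply: np; exists i.
have p_prime : prime p by case: fp.
have f_nconst : f \notin @logn_constants R p by apply/logn_constantsP.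
have De0 : logn_derivation p (Exp_chain f 0) != 0%R.
  apply: contraNneq f_nconst => /(logn_derivation_Exp_iter (Log_depth [set f])).
  rewrite mem_logn_constants /Exp_chain Log_iterK => [->//|].
  exact: (@Log_depth1_defined _ f).
move=> n x x_inj xS.
apply: (@tower_alg_independent _ [the subringClosed _ of @logn_constants R p]
  (Exp_chain f) _ (generated_subalg (range g))) => //.
- apply: (exp_tower_transcendental (@logn_derivation_leibniz R p) (@arith_pchar0 R)).
  + by move=> a /eqP.
  + exact: De0.
  + by move=> m; exact: Exp_neq0.
  + by move=> m; exact: logn_derivation_Exp.
- apply: smallest_sub; last by move=> _ [i _ <-]; apply/logn_constantsP.
  have [K1 KZ KM] := @logn_constants_subalg_closed R p.
  have toK (a : arith R) :
      (a \in [set` @logn_constants R p]) = (a \in @logn_constants R p).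
    by apply/idP/idP; rewrite inE.
  split=> [|a u v|u v]; first by rewrite [1%R \in _]toK.
    by rewrite [u \in _]toK [v \in _]toK [(_ + _)%R \in _]toK; exact: KZ.
  by rewrite [u \in _]toK [v \in _]toK [(_ * _)%R \in _]toK; exact: KM.
- by move=> i; exact: Exp_star1_sub.
Qed.
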